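(* Let $X$ be a paracompact Hausdorff space. Then $X$ is a $C$-space if and only if for every Hausdorff topological space $Y$ and every aspherical sequence $\varphi_n:X\leadsto Y$, $n<\omega$, of lower locally constant mappings, the union $\bigcup_{n<\omega}\varphi_n:X\leadsto Y$ has a continuous selection.
   Context: A space $X$ is a $C$-space if for any sequence $\{\mathscr{U}_n:n<\omega\}$ of open covers of $X$ there exists a sequence $\{\mathscr{V}_n:n<\omega\}$ of families of open subsets of $X$ such that each $\mathscr{V}_n$ is pairwise-disjoint (distinct members are disjoint), each $\mathscr{V}_n$ refines $\mathscr{U}_n$ (every member of $\mathscr{V}_n$ is contained in some member of $\mathscr{U}_n$), and $\bigcup_{n<\omega}\mathscr{V}_n$ is a cover of $X$. $\Phi:X\leadsto Y$ denotes a set-valued mapping, i.e. a map from $X$ to the nonempty subsets of $Y$. A map $f:X\to Y$ is a selection for $\Phi$ if $f(x)\in\Phi(x)$ for all $x\in X$. $\Phi:X\leadsto Y$ is lower locally constant if $\{x\in X: K\subset\Phi(x)\}$ is open in $X$ for every compact $K\subset Y$. For $k\geq 0$ and $S,B\subset Y$, write $S\stackrel{k}{\hookrightarrow}B$ if every continuous map from the $k$-sphere to $S$ can be extended to a continuous map from the $(k+1)$-ball to $B$. For $\varphi,\psi:X\leadsto Y$, write $\varphi\stackrel{k}{\hookrightarrow}\psi$ if $\varphi(x)\stackrel{k}{\hookrightarrow}\psi(x)$ for every $x\in X$. A sequence $\varphi_n:X\leadsto Y$, $n<\omega$, is aspherical if $\varphi_n\stackrel{n}{\hookrightarrow}\varphi_{n+1}$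 for every $n<\omega$. The union is defined pointwise by $[\bigcup_{n<\omega}\varphi_n](x)=\bigcup_{n<\omega}\varphi_n(x)$. *)

(* Defs.v *)
From HB Require Import structures.
From mathcomp Require Import all_boot all_order all_algebra.
From mathcomp Require Import all_classical all_reals all_analysis.

Set Implicit Arguments.
Unset Strict Implicit.
Unset Printing Implicit Defensive.

Import Order.TTheory GRing.Theory Num.Theory.
Import numFieldNormedType.Exports.

Local Open Scope classical_set_scope.
Local Open Scope ring_scope.

Section Covers.
Context (X : topologicalType).
Implicit Types U V : set (set X).

Definition open_family U := forall A, U A -> open A.

Definition covers_space U := \bigcup_(A in U) A = [set: X].

Definition open_cover U := open_family U /\ covers_space U.

Definition refines V U := forall B, V B -> exists2 A, U A & B `<=` A.

Definition locally_finite V :=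
  forall x : X, exists2 N, nbhs x N &
    finite_set [set B | V B /\ B `&` N !=set0].

(* Separation is not part of this predicate. *)
Definition paracompact :=
  forall U, open_cover U ->
    exists V, [/\ open_cover V, refines V U & locally_finite V].

(* [trivIset V id] only constrains distinct members of [V]. *)
Definition C_space :=
  forall U_ : nat -> set (set X), (forall n, open_cover (U_ n)) ->
    exists V_ : nat -> set (set X),
      [/\ forall n, open_family (V_ n),
          forall n, trivIset (V_ n) id,
          forall n, refines (V_ n) (U_ n)
        & covers_space (\bigcup_n V_ n)].

End Covers.
Arguments paracompact : clear implicits.
Arguments C_space : clear implicits.

(* The Euclidean norm is written out because the library's norm on matrices
   is the sup norm; the topology of ['rV[R]_n] is the usual one. *)
Definition unit_sphere (R : realType) (k : nat) : set 'rV[R]_k.+1 :=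
  [set x | \sum_(i < k.+1) x 0 i ^+ 2 = 1].

Definition unit_ball (R : realType) (n : nat) : set 'rV[R]_n :=
  [set x | \sum_(i < n) x 0 i ^+ 2 <= 1].
Arguments unit_sphere : clear implicits.
Arguments unit_ball : clear implicits.

(* A map on the sphere (ball) is represented by a total function on the ambient
   space of which only the restriction matters. Nothing is lost: the sphere is
   nonempty, so a map from it to [Y] exists only if [Y] is inhabited. *)
Definition sphere_extends (R : realType) (Y : topologicalType) (k : nat)
    (S B : set Y) :=
  forall f : 'rV[R]_k.+1 -> Y,
    {within unit_sphere R k, continuous f} ->
    f @` unit_sphere R k `<=` S ->
    exists g : 'rV[R]_k.+1 -> Y,
      [/\ {within unit_ball R k.+1, continuous g},
          g @` unit_ball R k.+1 `<=` B
        & forall x, unit_sphere R k x -> g x = f x].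

Section SetValued.
Context (X Y : topologicalType).
Implicit Types (phi psi : X -> set Y).

Definition nonempty_valued phi := forall x, phi x !=set0.

Definition selection phi (f : X -> Y) := forall x, phi x (f x).

Definition lower_locally_constant phi :=
  forall K : set Y, compact K -> open [set x | K `<=` phi x].

Definition map_sphere_extends (R : realType) (k : nat) phi psi :=
  forall x, sphere_extends R k (phi x) (psi x).

Definition aspherical (R : realType) (phi_ : nat -> X -> set Y) :=
  forall n, map_sphere_extends R n (phi_ n) (phi_ n.+1).

Definition union_map (phi_ : nat -> X -> set Y) : X -> set Y :=
  fun x => \bigcup_n phi_ n x.

End SetValued.

(* Main.v *)
(* From a C-space to a selection. Level by level one builds
   locally finite open covers W_0, W_1, ... and a map g into Y from the simplices
   with vertices (i, G), G in W_i, and at most one vertex per level, such that g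
   sends a k-dimensional simplex into phi_k(x) whenever x lies in the closures
   of all its vertices.  Given the levels below n, a point x sees finitely many
   simplices; asphericity extends g over the cone on them, one cube at a time, and
   lower local constancy together with compactness makes this cone valid on a
   neighbourhood of x.  W_n refines these neighbourhoods.  No choice in this
   construction depends on the disjoint families, so the C-space property can be
   applied once, to the finished sequence (W_n); disjointness gives at most one
   vertex per level at every x, and composing g with a partition of unity yields
   the selection.

   From selections to a C-space.  Refine the given covers to locally finite W_n
   and let phi_n(x) be the join of the discrete sets {G in W_i | x in G}, i <= n.
   Coning with a vertex of level n + 1 gives asphericity.  For a selection f, the
   sets {x | f(x) has positive coordinate at (n, G)}, G in W_n, are disjoint. *)

Require Import Defs.
From HB Require Import structures.
From mathcomp Require Import all_boot all_order all_algebra.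
From mathcomp Require Import finmap lra.
From mathcomp Require Import all_classical all_reals all_analysis.

Set Implicit Arguments.
Unset Strict Implicit.
Unset Printing Implicit Defensive.

Import Order.TTheory GRing.Theory Num.Theory.
Import numFieldNormedType.Exports.

Local Open Scope classical_set_scope.
Local Open Scope ring_scope.

(** * Paracompact spaces *)

(** Finite closed pasting, localized at [x]: a [C j] missing [x] imposes nothing, since its
    complement is a neighbourhood of [x]. *)
Lemma cvg_within_closed_cover (T S : topologicalType) (f : T -> S)
    (J : choiceType) (D : {fset J}) (C : J -> set T) (x : T) :
  (forall j, j \in D -> closed (C j)) ->
  (forall j, j \in D -> C j x -> f @ within (C j) (nbhs x) --> f x) ->
  f @ within (\bigcup_(j in [set` D]) C j) (nbhs x) --> f x.
Proof.
move=> clC fC U Ux.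
have nbj j : j \in D -> nbhs x [set y | C j y -> U (f y)].
  move=> jD; have [Cx|nCx] := pselect (C j x); first exact: (fC j jD Cx U Ux).
  have /open_nbhs_nbhs : open_nbhs x (~` C j).
    by split => //; exact: closed_openC (clC j jD).
  by apply: filterS => y nCy /nCy.
apply: filterS (filter_bigI (nbhs_filter x) nbj).
by move=> y Dy [j jD Cy]; exact: (Dy j jD Cy).
Qed.

Lemma cvg_ptws (T I : Type) (K : topologicalType) (F : set_system T)
    (f : T -> {ptws I -> K}) (l : {ptws I -> K}) : Filter F ->
  (forall i, (fun x => f x i) @ F --> l i) -> f @ F --> l.
Proof.
move=> FF cvi; apply/cvg_sup => i U [V [[W] oW <-] WfN WU].
have FW : F [set x | W (f x i)] := cvi i _ (open_nbhs_nbhs (conj oW WfN)).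
have : F [set x | U (f x)]; last by [].
by apply: filterS FW => x; exact: WU.
Qed.

Lemma continuous_ptws_proj (I : eqType) (K : topologicalType) (i : I) :
  continuous (fun t : {ptws I -> K} => t i).
Proof. exact: (@proj_continuous I (fun=> K) i). Qed.

Section LocallyFinite.
Context {X : topologicalType}.

(** Indexed, unlike [locally_finite], because one open set may serve as a vertex on several
    levels. *)
Definition locally_finite_family (J : Type) (W : set J) (F : J -> set X) :=
  forall x : X, exists2 N, nbhs x N & finite_set [set j | W j /\ F j `&` N !=set0].

(** Only finitely many members meet a suitable neighbourhood, so the closures missing [x] can be
    removed from it; an open set that meets [closure (F j)] already meets [F j]. *)
Lemma locally_finite_closure_nbhs (J : choiceType) (W : set J) (F : J -> set X)
    (x : X) : locally_finite_family W F ->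
  exists N, [/\ open N, N x, finite_set [set j | W j /\ F j `&` N !=set0] &
    forall j, W j -> closure (F j) `&` N !=set0 -> closure (F j) x].
Proof.
move=> /(_ x)[N Nx finN].
pose D := fset_set [set j | W j /\ F j `&` N !=set0].
pose C j := if pselect (closure (F j) x) then setT else ~` closure (F j).
have oC j : open (C j).
  rewrite /C; case: pselect => ?; first exact: openT.
  exact/closed_openC/closed_closure.
have Cx j : C j x by rewrite /C; case: pselect.
have nC : nbhs x (N° `&` \bigcap_(j in [set` D]) C j).
  apply: filterI; first exact: nbhs_interior.
  by apply: filter_bigI => j _; apply: open_nbhs_nbhs.
exists (N° `&` \bigcap_(j in [set` D]) C j)°.
have sub : (N° `&` \bigcap_(j in [set` D]) C j)° `<=` N.
  by move=> y /interior_subset[/interior_subset].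
split.
- exact: open_interior.
- exact: nC.
- apply: sub_finite_set finN => j [Wj [y [Fy /sub Ny]]]; split => //.
  by exists y.
- move=> j Wj [y [cFy Ny]].
  have : closure (F j) `&` N !=set0 by exists y; split => //; exact: sub.
  have jD : j \in D.
    rewrite in_fset_set// inE; split => //.
    have := cFy N°; case => [|z [Fz /interior_subset Nz]]; last by exists z.
    apply: open_nbhs_nbhs; split; first exact: open_interior.
    by move: Ny => /interior_subset[].
  move: Ny => /interior_subset[_ /(_ j jD)].
  by rewrite /C; case: pselect.
Qed.

Lemma closure_bigcup_locally_finite (J : choiceType) (W : set J)
    (F : J -> set X) : locally_finite_family W F ->
  closure (\bigcup_(j in W) F j) `<=` \bigcup_(j in W) closure (F j).
Proof.
move=> lf x clx; have [N [oN Nx _ cN]] := locally_finite_closure_nbhs x lf.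
have [y [[j Wj Fy] Ny]] := clx N (open_nbhs_nbhs (conj oN Nx)).
exists j => //; apply: cN => //; exists y; split => //.
exact: subset_closure.
Qed.

Lemma locally_finite_sub (J : Type) (W W' : set J) (F : J -> set X) :
  W' `<=` W -> locally_finite_family W F -> locally_finite_family W' F.
Proof.
move=> sW lf x; have [N Nx fN] := lf x; exists N => //.
by apply: sub_finite_set fN => j [/sW ? ?].
Qed.

End LocallyFinite.

Section Paracompact.
Context {X : topologicalType}.
Hypothesis X_hausdorff : hausdorff_space X.
Hypothesis X_paracompact : paracompact X.

(** In a locally finite refinement the members meeting [A] have closures off [B], and the closure of
    their union is the union of the closures. A singleton [B] yields regularity, the complement of
    an open set normality. *)
Lemma paracompact_separation (A B : set X) : closed A ->
  (forall a, A a -> exists U, [/\ open U, U a & closure U `<=` ~` B]) ->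
  exists V, [/\ open V, A `<=` V & closure V `<=` ~` B].
Proof.
move=> clA sep.
pose U := [set U : set X | open U /\ (closure U `<=` ~` B \/ U `<=` ~` A)].
have covU : open_cover U.
  split=> [W []//|]; apply/seteqP; split => // x _.
  have [/sep[W [oW Wx cW]]|nAx] := pselect (A x).
    by exists W => //; split => //; left.
  by exists (~` A) => //; split; [exact: closed_openC|right].
have [V [[oV covV] refV lfV]] := X_paracompact covU.
pose W := [set G | V G /\ G `&` A !=set0].
exists (\bigcup_(G in W) G); split.
- by apply: bigcup_open => G [VG _]; exact: oV.
- move=> x Ax; have : [set: X] x by [].
  by rewrite -covV => -[G VG Gx]; exists G => //; split => //; exists x.
- have lfW : locally_finite_family W id.
    by apply: (@locally_finite_sub _ _ V) => [G []//|]; exact: lfV.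
  move=> x /(closure_bigcup_locally_finite lfW)[G [VG [y [Gy Ay]]]] /=.
  have [H [oH [cH|HA]] GH] := refV _ VG; last by have := HA y (GH y Gy).
  by move=> cGx; apply: cH; exact: closureS GH _ cGx.
Qed.

Lemma paracompact_regular (x : X) (U : set X) : open U -> U x ->
  exists V, [/\ open V, V x & closure V `<=` U].
Proof.
move=> oU Ux.
have [|a nUa|V [oV UV cV]] := @paracompact_separation (~` U) [set x].
- exact: open_closedC.
- have xa : a != x by apply/eqP => ax; apply: nUa; rewrite ax.
  have [[P Q] /= [aP xQ] [oP oQ PQ]] :
      exists2 AB : set X * set X, a \in AB.1 /\ x \in AB.2 &
        [/\ open AB.1, open AB.2 & AB.1 `&` AB.2 == set0].
    by move: X_hausdorff; rewrite open_hausdorff; exact.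
  rewrite !inE in aP xQ; exists P; split => // y cy /= yx.
  have [z [Pz Qz]] := cy Q (open_nbhs_nbhs (conj oQ (eq_ind_r Q xQ yx))).
  by move/eqP : PQ => PQ; have : (P `&` Q) z by []; rewrite PQ.
exists (~` closure V); split.
- exact/closed_openC/closed_closure.
- by move=> /cV; exact.
- move=> y cy; apply: contrapT => nUy.
  have [z [nVz Vz]] := cy V (open_nbhs_nbhs (conj oV (UV _ nUy))).
  by apply: nVz; exact: subset_closure.
Qed.

Lemma paracompact_normal (A U : set X) : closed A -> open U -> A `<=` U ->
  exists V, [/\ open V, A `<=` V & closure V `<=` U].
Proof.
move=> clA oU AU.
have [|a Aa|V [oV AV cV]] := @paracompact_separation A (~` U) => //.
  have [V [oV Va cV]] := paracompact_regular oU (AU _ Aa).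
  by exists V; split => //; rewrite setCK.
by exists V; split => //; rewrite setCK in cV.
Qed.

Lemma paracompact_closure_refine (U : set (set X)) : open_cover U ->
  exists V, [/\ open_cover V, locally_finite V &
    forall B, V B -> exists2 A, U A & closure B `<=` A].
Proof.
move=> [oU cU].
pose U' := [set B | open B /\ exists2 A, U A & closure B `<=` A].
have /X_paracompact[V [oV rV lV]] : open_cover U'.
  split=> [B []//|]; apply/seteqP; split => // x _.
  have : [set: X] x by []; rewrite -cU => -[A UA Ax].
  have [B [oB Bx cB]] := paracompact_regular (oU _ UA) Ax.
  by exists B => //; split => //; exists A.
exists V; split => // B /rV[C [oC [A UA cC]] BC]; exists A => //.
exact: subset_trans (closureS BC) cC.
Qed.

(** Members of a closure refinement are grouped by a chosen index [i G]; local finiteness reduces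
    the closure of a group to the closures of its members. *)
Lemma paracompact_shrink (O_ : nat -> set X) :
  (forall n, open (O_ n)) -> \bigcup_n O_ n = setT ->
  exists E_ : nat -> set X, [/\ forall n, open (E_ n), \bigcup_n E_ n = setT &
    forall n, closure (E_ n) `<=` O_ n].
Proof.
move=> oO cO.
have /paracompact_closure_refine[V [[oV cV] lV rV]] : open_cover (range O_).
  split=> [_ [n _ <-]//|]; rewrite /covers_space.
  by apply/seteqP; split=> // x _; have : [set: X] x by [];
    rewrite -cO => -[n _ On]; exists (O_ n).
have idx G : exists n, V G -> closure G `<=` O_ n.
  have [/rV[_ [n _ <-] GO]|nV] := pselect (V G); first by exists n.
  by exists 0%N.
have /choice[i iP] := idx.
exists (fun n => \bigcup_(G in [set G | V G /\ i G = n]) G); split.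
- by move=> n; apply: bigcup_open => G [VG _]; exact: oV.
- apply/seteqP; split=> // x _; have : [set: X] x by [].
  by rewrite -cV => -[G VG Gx]; exists (i G) => //; exists G.
- move=> n x.
  have lf : locally_finite_family [set G | V G /\ i G = n] id.
    by apply: (@locally_finite_sub _ _ V) => [G []//|]; exact: lV.
  move=> /(closure_bigcup_locally_finite lf)[G [VG <-]].
  exact: iP.
Qed.

Lemma paracompact_bump (R : realType) (A U : set X) :
  closed A -> open U -> A `<=` U ->
  exists f : X -> R, [/\ continuous f, forall x, 0 <= f x <= 1,
    forall x, f x != 0 -> U x & forall x, A x -> f x = 1].
Proof.
move=> clA oU AU.
have nX : normal_space X.
  move=> B clB C /set_nbhsP[D [oD BD DC]].
  have [V [oV BV cV]] := paracompact_normal clB oD BD.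
  exists V; first by (apply/set_nbhsP; exists V; split).
  exact: subset_trans cV DC.
have /(@uniform_separatorP _ R)[f [cf f01 f0 f1]] : uniform_separator (~` U) A.
  move/(@normal_separatorP R) : nX; apply => //; first exact: open_closedC.
  by apply/seteqP; split=> // x [nUx /AU].
exists f; split=> //.
- by move=> x; have := f01 _ (imageT f x); rewrite /= in_itv.
- move=> x /eqP fx; apply: contrapT => nUx; apply: fx.
  by apply: f0; exists x.
- by move=> x Ax; apply: f1; exists x.
Qed.

(* A surrogate for a partition of unity: the functions are normalized by having
   maximum [1] rather than sum [1], which keeps all formulas free of sums. *)
Lemma paracompact_max_partition (R : realType) (O_ : nat -> set X) :
  (forall n, open (O_ n)) -> \bigcup_n O_ n = setT ->
  exists p : nat -> X -> R,
    [/\ forall n, continuous (p n), forall n x, 0 <= p n x <= 1,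
        forall n x, p n x != 0 -> O_ n x,
        forall x : X, exists n, p n x = 1 &
        forall x : X, exists m, \forall y \near x, forall n, (m <= n)%N -> p n y = 0].
Proof.
move=> oO cO.
have [E [oE cE EO]] := paracompact_shrink oO cO.
have [E' [oE' cE' E'E]] := paracompact_shrink oE cE.
have /choice[u uP] : forall n, exists f : X -> R, [/\ continuous f,
    forall x, 0 <= f x <= 1, forall x, f x != 0 -> O_ n x &
    forall x, closure (E n) x -> f x = 1].
  by move=> n; apply: paracompact_bump => //; exact: closed_closure.
have /choice[v vP] : forall n, exists f : X -> R, [/\ continuous f,
    forall x, 0 <= f x <= 1, forall x, f x != 0 -> E n x &
    forall x, closure (E' n) x -> f x = 1].
  by move=> n; apply: paracompact_bump => //; exact: closed_closure.
(* At the least [m] with [E m x] all [v i x], [i < m], vanish, so the [m]-th function is 1 at [x].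
   On [E' m] the factor [1 - v m] is 0 and kills all functions of larger index. *)
pose q n x := \prod_(i < n) (1 - v i x).
have q01 n x : 0 <= q n x <= 1.
  apply/andP; split.
    by apply: prodr_ge0 => i _; have [_ /(_ x)/andP[? ?] _ _] := vP i; rewrite subr_ge0.
  apply: prodr_ile1 => i _; have [_ /(_ x)/andP[? ?] _ _] := vP i.
  by rewrite subr_ge0; apply/andP; split => //; rewrite gerBl.
exists (fun n x => u n x * q n x); split.
- move=> n x; apply: cvgM; first by have [/(_ x)] := uP n.
  rewrite /q; elim: n => [|n IHn].
    by under eq_fun do rewrite big_ord0; rewrite big_ord0; exact: cvg_cst.
  under eq_fun do rewrite big_ord_recr/=.
  rewrite big_ord_recr/=; apply: cvgM => //.
  by apply: cvgB; [exact: cvg_cst|have [/(_ x)] := vP n].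
- move=> n x; have /andP[q0 q1] := q01 n x.
  have [_ /(_ x)/andP[u0 u1] _ _] := uP n.
  by rewrite mulr_ge0//= mulr_ile1.
- move=> n x; rewrite mulf_eq0 negb_or => /andP[un _].
  by have [_ _ + _] := uP n; apply.
- move=> x; have [n0 _ En0] : (\bigcup_n E n) x by rewrite cE.
  have ex : exists n, `[< E n x >] by exists n0; apply/asboolP.
  case: (ex_minnP ex) => m /asboolP Em minm.
  exists m; have [_ _ _ -> //] := uP m; last exact: subset_closure.
  rewrite mul1r /q big1// => i _.
  have [_ _ vE _] := vP i.
  have [->|/vE Ei] := eqVneq (v i x) 0; first by rewrite subr0.
  by have := minm i (introT (asboolP _) Ei); rewrite leqNgt ltn_ord.
- move=> x; have [m _ Em] : (\bigcup_n E' n) x by rewrite cE'.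
  exists m.+1; near=> y => n mn.
  rewrite /q (bigD1 (Ordinal mn))//=; have [_ _ _ ->] := vP m.
    by rewrite subrr mul0r mulr0.
  apply: subset_closure; near: y; exact: open_nbhs_nbhs.
Unshelve. all: by end_near. Qed.

End Paracompact.

(** * Extending maps over cubes and cones *)

Lemma within_continuous_compW (T U V : topologicalType) (A : set T)
    (B : set U) (f : T -> U) (g : U -> V) :
  {within A, continuous f} -> (forall x, A x -> B (f x)) ->
  {within B, continuous g} -> {within A, continuous (fun x => g (f x))}.
Proof.
move=> /subspace_continuousP cf AB /subspace_continuousP cg.
apply/subspace_continuousP => x Ax W /(cg _ (AB _ Ax)) gW.
have fW : nbhs x [set y | A y -> B (f y) -> W (g (f y))] := cf x Ax _ gW.
have : nbhs x [set y | A y -> W (g (f y))]; last by [].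
by apply: filterS fW => y Py Ay; exact: (Py Ay (AB _ Ay)).
Qed.

Lemma cvg_rV (T : Type) (K : topologicalType) (n : nat) (F : set_system T)
    (f : T -> 'rV[K]_n) (v : 'rV[K]_n) : Filter F ->
  (forall j, (fun x => f x 0 j) @ F --> v 0 j) -> f @ F --> v.
Proof.
move=> FF fv A [P vP PA].
have : \forall x \near F, forall j, P 0 j (f x 0 j).
  by apply: filter_forall => j; apply: fv; exact: vP.
by apply: filterS => x Px; apply: PA => i j; rewrite (ord1 i).
Qed.

Section Norms.
Context {R : realType} {n : nat}.
Implicit Types v w : 'rV[R]_n.

Definition norm2 v : R := Num.sqrt (\sum_(i < n) v 0 i ^+ 2).

Lemma norm2_sqr v : norm2 v ^+ 2 = \sum_(i < n) v 0 i ^+ 2.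
Proof. by rewrite sqr_sqrtr// sumr_ge0// => i _; exact: sqr_ge0. Qed.

Lemma norm2Z a v : 0 <= a -> norm2 (a *: v) = a * norm2 v.
Proof.
move=> a0; rewrite /norm2; under eq_bigr do rewrite mxE exprMn.
by rewrite -mulr_sumr sqrtrM ?sqr_ge0// sqrtr_sqr ger0_norm.
Qed.

Lemma norm2_eq0 v : norm2 v = 0 -> v = 0.
Proof.
move=> /(congr1 (fun x => x ^+ 2)); rewrite norm2_sqr expr0n/= => /eqP.
rewrite psumr_eq0; last by move=> i _; exact: sqr_ge0.
move=> /allP v0; apply/rowP => j; rewrite mxE.
by have := v0 j (mem_index_enum _); rewrite /= sqrf_eq0 => /eqP.
Qed.

Lemma norm2_continuous : continuous (@norm2).
Proof.
have csum (s : seq 'I_n) : continuous (fun v : 'rV[R]_n => \sum_(i <- s) v 0 i ^+ 2).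
  elim: s => [|i s IHs] v.
    rewrite (_ : (fun v : 'rV[R]_n => _) = cst 0); first by exact: cst_continuous.
    by apply/funext => w; rewrite big_nil.
  rewrite (_ : (fun v : 'rV[R]_n => _) =
      (fun v => v 0 i * v 0 i) \+ (fun v => \sum_(i <- s) v 0 i ^+ 2)); last first.
    by apply/funext => w; rewrite big_cons expr2.
  by apply: continuousD; [apply: continuousM; exact: coord_continuous|exact: IHs].
move=> v; apply: (@continuous_comp _ _ _ (fun v : 'rV[R]_n => \sum_(i < n) v 0 i ^+ 2)
  (@Num.sqrt R)); [exact: csum|exact: sqrt_continuous].
Qed.

Lemma rV_norm_coord v i : `|v 0 i| <= `|v|.
Proof.
have /mapP[j Hj ->] : `|v 0 i| \in [seq `|v x.1 x.2| | x : 'I_1 * 'I_n].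
  by apply/mapP; exists (ord0, i) => //=; rewrite mem_enum.
by rewrite [leRHS]/Num.Def.normr /= mx_normrE; apply/bigmax_geP; right => /=; exists j.
Qed.

Lemma rV_norm_le v (c : R) : 0 <= c -> (forall i, `|v 0 i| <= c) -> `|v| <= c.
Proof.
move=> c0 vc; rewrite [leLHS]/Num.Def.normr /= mx_normrE; apply/bigmax_leP; split => //.
by move=> [i j] _ /=; rewrite (ord1 i).
Qed.

Lemma rV_norm_attained v : v != 0 -> exists i, `|v| = `|v 0 i|.
Proof.
move=> v0; have : mx_norm v != 0 by apply/eqP => /mx_norm_eq0 /eqP; exact/negP.
by move=> /mx_norm_neq0[[i j] /= vE]; exists j; rewrite [LHS]/Num.Def.normr /= vE (ord1 i).
Qed.

Lemma continuous_rescale (d : 'rV[R]_n -> R) v :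
  d v != 0 -> {for v, continuous d} ->
  {for v, continuous (fun w => (d w)^-1 *: w)}.
Proof.
by move=> d0 cd; exact: (cvgZ (continuousV d0 cd) (@cvg_id _ (nbhs v))).
Qed.

End Norms.

Section Cube.
Context {R : realType} {I : choiceType}.
Implicit Types A B : {fset I}.

(** Points are functions on all of [I], so all cubes lie in one product space and the cube of a
    subset of [A] is literally a face. *)
Definition cube A : set {ptws I -> R} := [set t | forall a, 0 <= t a <= (a \in A)%:R].

(* Barycentric coordinates are normalized by [max t = 1]; in this model the cone
   over the simplex [A] with apex [0] is [cube A]. *)
Definition simplex A : set {ptws I -> R} := [set t | cube A t /\ exists a, t a = 1].

(** The faces [t a = 0] are cubes of smaller sets; the faces [t a = 1] together form [simplex A]. *)
Definition cube_boundary A : set {ptws I -> R} :=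
  [set t | cube A t /\ exists2 a, a \in A & t a = 0 \/ t a = 1].

Lemma cube01 A t a : cube A t -> 0 <= t a <= 1.
Proof.
by move=> /(_ a)/andP[-> /= ta]; rewrite (le_trans ta)// lern1; case: (_ \in _).
Qed.

Lemma cube_out A t a : cube A t -> a \notin A -> t a = 0.
Proof.
by move=> /(_ a) + /negbTE aA; rewrite aA -eq_le => /eqP.
Qed.

Lemma cubeP A t : (forall a, 0 <= t a <= 1) -> (forall a, a \notin A -> t a = 0) ->
  cube A t.
Proof.
move=> t01 t0 a; have [aA|/t0 ->] := boolP (a \in A); first exact: t01.
by rewrite lexx.
Qed.

Lemma simplexP A t : simplex A t -> exists2 a, a \in A & t a = 1.
Proof.
move=> [tA [a ta]]; exists a => //; apply: contraT => /(cube_out tA).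
by rewrite ta => /eqP; rewrite oner_eq0.
Qed.

Lemma cube_fsetD1 A t a : cube A t -> t a = 0 -> cube (A `\ a)%fset t.
Proof.
move=> tA ta; apply: cubeP => b; first exact: cube01 tA.
by rewrite in_fsetD1 negb_and negbK => /orP[/eqP ->//|]; exact: cube_out tA.
Qed.

Lemma closed_coord (a : I) (C : set R) : closed C ->
  closed [set t : {ptws I -> R} | C (t a)].
Proof.
have /continuous_closedP := @continuous_ptws_proj I R a; exact.
Qed.

Lemma cubeE A : cube A = \bigcap_a [set t | `[0, (a \in A)%:R]%classic (t a)].
Proof.
apply/seteqP; split=> t tA a; first by move=> _; rewrite /= in_itv; exact: tA.
by have := tA a Logic.I; rewrite /= in_itv.
Qed.

Lemma closed_cube A : closed (cube A).
Proof.
rewrite cubeE; apply: closed_bigI => a _; apply: closed_coord.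
exact: interval_closed.
Qed.

Lemma compact_cube A : compact (cube A).
Proof.
have -> : cube A = [set t : forall a : I, R | forall a, `[0, (a \in A)%:R]%classic (t a)].
  by apply/seteqP; split=> t tA a; have := tA a; rewrite /= in_itv.
have := @tychonoff I (fun=> R) (fun a => `[0, (a \in A)%:R]%classic); apply => a.
exact: segment_compact.
Qed.

(* The cube is identified with the Euclidean ball through
   [v |-> v / (|v|_2 + 1 - |v|_oo)], where [v = 2 t - 1]; on the boundary
   [|v|_oo = 1], so there the inverse is [y |-> y / |y|_oo]. *)
Lemma cube_extension (Y : topologicalType) (S S' : set Y) A m
    (h : {ptws I -> R} -> Y) :
  #|` A| = m.+1 -> sphere_extends R m S S' ->
  {within cube_boundary A, continuous h} ->
  (forall t, cube_boundary A t -> S (h t)) ->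
  exists k : {ptws I -> R} -> Y, [/\ {within cube A, continuous k},
    forall t, cube A t -> S' (k t) & forall t, cube_boundary A t -> k t = h t].
Proof.
move=> cA ext ch hS.
have [a0 a0A] : exists a, a \in A.
  by apply/fset0Pn; rewrite -cardfs_gt0 cA.
pose e (i : 'I_m.+1) : I := nth a0 A i.
pose idx (a : I) : 'I_m.+1 := inord (index a A).
have eA i : e i \in A by rewrite mem_nth// cA.
have idxK i : idx (e i) = i.
  by apply: val_inj; rewrite /idx /e index_uniq ?cA//= inordK.
have eK a : a \in A -> e (idx a) = a.
  by move=> aA; rewrite /e /idx inordK ?nth_index// -cA index_mem.
have [v vE] : exists v : {ptws I -> R} -> 'rV[R]_m.+1,
    forall t i, v t 0 i = 2 * t (e i) - 1.
  by exists (fun t => \row_i (2 * t (e i) - 1)) => t i; rewrite mxE.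
pose emb (w : 'rV[R]_m.+1) : {ptws I -> R} :=
  fun a => if a \in A then (1 + w 0 (idx a)) / 2 else 0.
have embv t : cube A t -> emb (v t) = t.
  move=> tA; apply/funext => a; rewrite /emb; case: ifPn => aA.
    by rewrite vE eK//; lra.
  by rewrite (cube_out tA).
have cv : continuous v.
  move=> t.
  apply: (@cvg_rV _ _ _ (nbhs t) v).
  move=> j; rewrite vE.
  have -> : (fun t => v t 0 j) = (fun t : {ptws I -> R} => 2 * t (e j) - 1).
    by apply/funext => s; rewrite vE.
  apply: cvgB; last exact: cvg_cst.
  apply: cvgM; first exact: cvg_cst.
  exact: (@continuous_ptws_proj I R (e j)).
have cemb : continuous emb.
  move=> w; apply: (@cvg_ptws _ _ _ (nbhs w) emb) => a.
  rewrite /emb; case: ifPn => aA; last exact: cvg_cst.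
  apply: cvgM; last exact: cvg_cst.
  by apply: cvgD; [exact: cvg_cst|exact: coord_continuous].
have v_le1 t : cube A t -> `|v t| <= 1.
  move=> tA; apply: rV_norm_le => // i; rewrite vE ler_norml.
  by have /andP[? ?] := cube01 (e i) tA; apply/andP; split; lra.
have v_bd t : cube_boundary A t -> `|v t| = 1.
  move=> [tA [a aA ta]]; apply/eqP; rewrite eq_le v_le1//=.
  have <- : `|v t 0 (idx a)| = 1.
    rewrite vE eK//; case: ta => ->; first by rewrite mulr0 sub0r normrN normr1.
    by rewrite (_ : 2 * 1 - 1 = 1 :> R) ?normr1//; lra.
  exact: rV_norm_coord.
have emb_bd w : `|w| = 1 -> cube_boundary A (emb w).
  move=> w1; split.
    apply: cubeP => a; rewrite /emb; case: ifPn => // aA.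
      have := rV_norm_coord w (idx a); rewrite w1 ler_norml => /andP[? ?].
      by apply/andP; split; lra.
    by rewrite lexx ler01.
  have [|i wi] := @rV_norm_attained _ _ w.
    by apply: contra_eq_neq w1 => ->; rewrite normr0 eq_sym oner_eq0.
  exists (e i) => //; rewrite /emb eA idxK.
  move: wi; rewrite w1; have [w0 <-|w0 wi] := ger0P (w 0 i); first by right; lra.
  by left; lra.
(* For sup norm at most 1 this is positive, as [norm2] vanishes only at 0, where [d] is 1. Also
   [norm2 w <= d w], with equality at sup norm 1, so the cube goes to the ball and its boundary to
   the sphere. *)
pose d (w : 'rV[R]_m.+1) : R := norm2 w + (1 - `|w|).
have d_gt0 w : `|w| <= 1 -> 0 < d w.
  rewrite /d => w1; have := sqrtr_ge0 (\sum_(i < m.+1) w 0 i ^+ 2).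
  rewrite -/(norm2 w) le_eqVlt => /orP[/eqP n0|n0]; last by lra.
  by have -> := norm2_eq0 (esym n0); rewrite normr0 /norm2 subr0 ltr_wpDl ?sqrtr_ge0.
have norm_gt0 y : unit_sphere R m y -> 0 < `|y|.
  move=> y1; rewrite normr_gt0; apply/eqP => y0; move: y1; rewrite y0 /unit_sphere/=.
  rewrite big1; first by move=> /eqP; rewrite eq_sym oner_eq0.
  by move=> i _; rewrite mxE expr0n.
pose f0 (y : 'rV[R]_m.+1) := h (emb (`|y|^-1 *: y)).
have bd_y y : unit_sphere R m y -> cube_boundary A (emb (`|y|^-1 *: y)).
  move=> /norm_gt0 y0; apply: emb_bd.
  by rewrite normrZ ger0_norm ?invr_ge0 ?ltW// mulVf// gt_eqF.
have [|_ [y y1 <-]|g [cg gB gf]] := ext f0.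
- rewrite /f0; apply: (within_continuous_compW _ bd_y ch).
  apply: continuous_in_subspaceT => y; rewrite inE => /norm_gt0 y0.
  have y0' : `|y| != 0 by rewrite gt_eqF.
  have cy := @continuous_rescale _ _ (fun y => `|y|) y y0'
    (@norm_continuous _ 'rV[R]_m.+1 y).
  exact: (continuous_comp cy (cemb _)).
- exact/hS/bd_y.
pose H t := (d (v t))^-1 *: v t.
have HB t : cube A t -> unit_ball R m.+1 (H t).
  move=> /v_le1 v1; have d0 := d_gt0 _ v1.
  have n1 : norm2 (H t) <= 1.
    have di : 0 <= (d (v t))^-1 by rewrite invr_ge0 ltW.
    by rewrite norm2Z// ler_pdivrMl// mulr1 /d; lra.
  rewrite /unit_ball/= -norm2_sqr.
  by rewrite (le_trans (ler_pM _ _ n1 n1))// ?sqrtr_ge0// mulr1.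
exists (fun t => g (H t)); split.
- apply: within_continuous_compW HB cg.
  apply: continuous_in_subspaceT => t; rewrite inE => /v_le1 v1.
  have d0 : d (v t) != 0 by rewrite gt_eqF// d_gt0.
  have cd : {for v t, continuous d}.
    apply: (cvgD (@norm2_continuous _ _ (v t))).
    exact: (cvgB (cvg_cst _) (@norm_continuous _ 'rV[R]_m.+1 (v t))).
  exact: (continuous_comp (cv t) (continuous_rescale d0 cd)).
- by move=> t tA; apply: gB; exists (H t) => //; exact: HB.
- move=> t tA; have v1 := v_bd _ tA; have tc : cube A t by case: tA.
  have n0 : 0 < norm2 (v t) by have := d_gt0 (v t); rewrite /d v1 subrr addr0; exact.
  have dE : d (v t) = norm2 (v t) by rewrite /d v1 subrr addr0.
  have ni : 0 <= (norm2 (v t))^-1 by rewrite invr_ge0 ltW.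
  have Hs : unit_sphere R m (H t).
    rewrite /unit_sphere/= -norm2_sqr /H dE norm2Z//.
    by rewrite mulVf ?expr1n// gt_eqF.
  rewrite gf// /f0 /H dE normrZ v1 mulr1 ger0_norm//.
  by rewrite scalerA invrK mulfV ?gt_eqF// scale1r embv.
Qed.

End Cube.

Lemma within_continuous_eq (T U : topologicalType) (A : set T) (f g : T -> U) :
  (forall x, A x -> f x = g x) ->
  {within A, continuous f} -> {within A, continuous g}.
Proof.
by move=> fg; apply: subspace_eq_continuous => x; rewrite inE; exact: fg.
Qed.

Lemma within_continuous_cvg (T U : topologicalType) (A B : set T) (f : T -> U)
    (x : T) :
  {within B, continuous f} -> A `<=` B -> A x ->
  f @ within A (nbhs x) --> f x.
Proof. by move=> cf /continuous_subspaceW /(_ cf)/subspace_continuousP; exact. Qed.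

Section Cone.
Context {R : realType} {I : choiceType} {Y : topologicalType}.
Variables (S_ : nat -> set Y) (K : set {fset I}) (g : {ptws I -> R} -> Y).
Hypothesis S0 : S_ 0 !=set0.
Hypothesis S_ext : forall n, sphere_extends R n (S_ n) (S_ n.+1).
Hypothesis K_sub : forall A B : {fset I}, K B -> (A `<=` B)%fset -> K A.
Hypothesis g_cont : forall A, K A -> {within simplex A, continuous g}.
Hypothesis g_val : forall A t, K A -> simplex A t -> S_ #|` A|.-1 (g t).

(** Induction over skeleta. The boundary of a cube on [N.+1] vertices is an [N]-sphere already
    mapped into [S_ N]: by smaller cubes where [t a = 0], by [g] where [t a = 1]. [S_ext] fills it
    inside [S_ N.+1]. *)
Lemma cone_extension (N : nat) : exists h : {ptws I -> R} -> Y,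
  [/\ forall A t, K A -> simplex A t -> h t = g t,
      forall A, K A -> (#|` A| <= N)%N -> {within cube A, continuous h} &
      forall A t, K A -> (#|` A| <= N)%N -> cube A t -> S_ #|` A| (h t)].
Proof.
elim: N => [|N [h [hg hc hS]]].
  have [y0 Sy0] := S0.
  (* The apex goes to a point of [S_ 0]; off the apex [g] gives the values prescribed on
     simplices. *)
  pose h (t : {ptws I -> R}) := if pselect (forall a, t a = 0) then y0 else g t.
  have h0 A t : (#|` A| <= 0)%N -> cube A t -> h t = y0.
    rewrite leqn0 cardfs_eq0 => /eqP -> t0; rewrite /h; case: pselect => // -[] a.
    by apply: cube_out t0 _; rewrite in_fset0.
  exists h; split.
  - move=> A t KA [_ [a ta]]; rewrite /h; case: pselect => // t0.
    by have /eqP := t0 a; rewrite ta oner_eq0.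
  - move=> A KA A0; apply: (@within_continuous_eq _ _ _ (cst y0)).
      by move=> t At; rewrite (h0 A).
    by apply: continuous_subspaceT; exact: cst_continuous.
  - move=> A t KA A0 At; rewrite (h0 A)//; move: A0.
    by rewrite leqn0 => /eqP ->.
have bdE (B : {fset I}) t : cube_boundary B t -> exists2 a, a \in B &
    (cube (B `\ a)%fset t \/ simplex B t).
  move=> [Bt [a aB [ta|ta]]]; exists a => //; last by right; split => //; exists a.
  by left; exact: cube_fsetD1.
have : forall B, exists k : {ptws I -> R} -> Y, K B -> #|` B| = N.+1 ->
    [/\ {within cube B, continuous k}, forall t, cube B t -> S_ N.+1 (k t) &
        forall t, cube_boundary B t -> k t = h t].
  move=> B; have [[KB cB]|nB] := pselect (K B /\ #|` B| = N.+1); last first.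
    by exists g => KB cB; exfalso; apply: nB.
  have cBa a : a \in B -> #|` (B `\ a)%fset| = N.
    by move=> aB; have := cardfsD1 a B; rewrite aB cB => -[].
  have KBa a : K (B `\ a)%fset by apply: K_sub KB _; exact: fsubD1set.
  have [| |k kP] := @cube_extension R I Y _ _ B N h cB (@S_ext N).
  (* Continuity on the boundary is pasted from the closed faces, indexed by a value 0 or 1 and an
     element of [B]. *)
  - pose D := ([fset true; false] `*` B)%fset.
    pose C (j : bool * I) := [set t : {ptws I -> R} | cube B t /\ t j.2 = j.1%:R].
    have bdC : cube_boundary B = \bigcup_(j in [set` D]) C j.
      apply/seteqP; split=> t.
        move=> [Bt [a aB [ta|ta]]].
          by exists (false, a) => //=; rewrite in_fsetM !inE.
        by exists (true, a) => //=; rewrite in_fsetM !inE.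
      move=> [[b a] /=]; rewrite in_fsetM => /andP[_ /= aB] [Bt /= ta].
      by split => //; exists a => //; case: b ta => ->; [right|left].
    apply/subspace_continuousP => x _; rewrite bdC.
    apply: cvg_within_closed_cover => -[b a]; rewrite in_fsetM => /andP[_ /= aB].
      apply: closedI; first exact: closed_cube.
      apply: (@closed_coord R I a [set b%:R]).
      exact: closed_eq.
    move=> Cx; have Ca : C (b, a) `<=` if b then simplex B else cube (B `\ a)%fset.
      case: b {Cx} => t [/= Bt ta]; first by split => //; exists a.
      exact: cube_fsetD1.
    apply: within_continuous_cvg Ca Cx; case: b => /=.
      apply: (within_continuous_eq _ (g_cont KB)) => t Bt.
      exact: (esym (hg B t KB Bt)).
    by apply: hc => //; rewrite cBa.
  - move=> t /bdE[a aB [ta|ta]]; last by rewrite (hg B)//; have := g_val KB ta; rewrite cB.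
    by rewrite -(cBa a)//; apply: hS => //; rewrite cBa.
  - by exists k.
move=> /choice[k kP].
(* Here [B] is the support of [t], hence unique. The filling [k B] is used only at full support;
   elsewhere on [cube B] it agrees with [h], so the pieces match. *)
pose P t B := [/\ K B, #|` B| = N.+1 & forall a : I, (t a != 0 :> R) = (a \in B)].
have Pinj t B B' : P t B -> P t B' -> B = B'.
  by move=> [_ _ BE] [_ _ B'E]; apply/fsetP => a; rewrite -BE B'E.
have Psub t B A : P t B -> cube A t -> (B `<=` A)%fset.
  move=> [_ _ BE] tA; apply/fsubsetP => a; rewrite -BE.
  by apply: contraR => /(cube_out tA) ->.
pose h' t := if pselect (exists B, P t B) is left e then k (projT1 (cid e)) t else h t.
have h'k t B : P t B -> h' t = k B t.
  move=> PB; rewrite /h'; case: pselect => [e|[]]; last by exists B.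
  by case: (cid e) => B' /= PB'; rewrite (Pinj _ _ _ PB PB').
have h'h t : (forall B, ~ P t B) -> h' t = h t.
  move=> nP; rewrite /h'; case: pselect => // e.
  by exfalso; case: e => B /nP.
have h'_small A t : (#|` A| <= N)%N -> cube A t -> h' t = h t.
  move=> AN At; apply: h'h => B PB; have := fsubset_leq_card (Psub _ _ _ PB At).
  by case: PB => _ -> _ /leq_trans/(_ AN); rewrite ltnn.
have h'_top B t : K B -> #|` B| = N.+1 -> cube B t -> h' t = k B t.
  move=> KB cB Bt; have [[a aB ta]|full] := pselect (exists2 a, a \in B & t a = 0).
    have [_ _ ->//] := kP B KB cB; last by split => //; exists a => //; left.
    apply: (h'_small (B `\ a)%fset).
      by have := cardfsD1 a B; rewrite aB cB => -[->].
    exact: cube_fsetD1.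
  apply: h'k; split => // a; apply/idP/idP => [|aB].
    by apply: contraR => /(cube_out Bt) ->.
  by apply/eqP => ta; apply: full; exists a.
exists h'; split.
- move=> A t KA At; have [[B PB]|nP] := pselect (exists B, P t B); last first.
    by rewrite h'h; [exact: hg At|move=> B PB; apply: nP; exists B].
  have [tA [a ta]] := At.
  have [KB cB BE] := PB.
  have Bt : simplex B t.
    split; last by exists a.
    apply: cubeP => b; first exact: cube01 tA.
    by rewrite -BE negbK => /eqP.
  rewrite (h'k _ _ PB); have [_ _ ->] := kP B KB cB; first exact: hg KB Bt.
  have [b bB tb] := simplexP Bt.
  by split; [case: Bt|exists b => //; right].
- move=> A KA; rewrite leq_eqVlt => /orP[/eqP cA|AN].
    have [kc _ _] := kP A KA cA.
    by apply: within_continuous_eq kc => t At; rewrite (h'_top A).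
  by apply: within_continuous_eq (hc _ KA AN) => t At; rewrite (h'_small A).
- move=> A t KA; rewrite leq_eqVlt => /orP[/eqP cA At|AN At].
    by rewrite (h'_top A)// cA; have [_ + _] := kP A KA cA; apply.
  by rewrite (h'_small A)//; exact: hS.
Qed.

End Cone.

(** * Selections on C-spaces *)

Lemma locally_finite_familyU (X : topologicalType) (J : Type) (V W : set J)
    (F : J -> set X) : locally_finite_family V F -> locally_finite_family W F ->
  locally_finite_family (V `|` W) F.
Proof.
move=> lV lW x; have [M Mx fM] := lV x; have [N Nx fN] := lW x.
exists (M `&` N); first exact: filterI.
apply: (@sub_finite_set _ _ ([set j | V j /\ F j `&` M !=set0] `|`
  [set j | W j /\ F j `&` N !=set0])); last by rewrite finite_setU.
by move=> j [[Vj|Wj] [y [Fy [My Ny]]]]; [left|right]; split => //; exists y.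
Qed.

Section Stages.
Context {R : realType} {X Y : topologicalType}.
Hypothesis X_hausdorff : hausdorff_space X.
Hypothesis X_paracompact : paracompact X.
Variable phi_ : nat -> X -> set Y.
Hypothesis phi0 : forall n, nonempty_valued (phi_ n).
Hypothesis phi_llc : forall n, lower_locally_constant (phi_ n).
Hypothesis phi_asph : aspherical R phi_.

(* A vertex [(n, G)] stands for the member [G] of the [n]-th cover. *)
Local Notation I := (nat * set X)%type.
Local Notation T := {ptws I -> R}.

(** Closures make flags semicontinuous: over a locally finite [W] no new flag appears at points near
    [x]. *)
Definition flag (W : set I) (x : X) : set {fset I} :=
  [set A | (forall a, a \in A -> W a /\ closure a.2 x) /\
           {in A &, injective fst}].

Lemma flag_sub (W : set I) (x : X) (A B : {fset I}) :
  flag W x B -> (A `<=` B)%fset -> flag W x A.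
Proof.
move=> [BW Binj] /fsubsetP AB; split=> [a /AB/BW//|a b /AB aB /AB bB].
exact: Binj.
Qed.

(** The invariant of the construction. One map serves all [x], which only select the simplices where
    it is controlled; the index of [phi_] is the dimension of the simplex. *)
Definition stage n (s : set I * (T -> Y)) :=
  [/\ forall a, s.1 a -> (a.1 < n)%N,
      locally_finite_family s.1 snd,
      forall x A, flag s.1 x A -> {within simplex A, continuous s.2} &
      forall x A t, flag s.1 x A -> simplex A t -> phi_ #|` A|.-1 x (s.2 t)].

(** The flags at [x] form a finite complex, to which [cone_extension] applies. Each cube has compact
    image, which lower local constancy keeps inside the values at nearby points. *)
Lemma stage_cone n s x : stage n s -> exists hQ : (T -> Y) * set X,
  [/\ open hQ.2 /\ hQ.2 x,
      forall A t, flag s.1 x A -> simplex A t -> hQ.1 t = s.2 t,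
      forall A, flag s.1 x A -> {within cube A, continuous hQ.1},
      forall z, hQ.2 z -> flag s.1 z `<=` flag s.1 x &
      forall z A t, hQ.2 z -> flag s.1 x A -> cube A t -> phi_ #|` A| z (hQ.1 t)].
Proof.
move=> [lev lf sc sS].
have [N [oN Nx finN cN]] := locally_finite_closure_nbhs x lf.
pose V := [set a | s.1 a /\ closure a.2 x].
have finV : finite_set V.
  apply: sub_finite_set finN => a [sa cl]; split => //.
  by have [y [? ?]] := cl N (open_nbhs_nbhs (conj oN Nx)); exists y.
have flagV A : flag s.1 x A -> (A `<=` fset_set V)%fset.
  by move=> [AW _]; apply/fsubsetP => a /AW aV; rewrite in_fset_set// inE.
have [h [hg hc hS]] := @cone_extension R I Y (phi_^~ x) (flag s.1 x) s.2
  (@phi0 0 x) (fun n => @phi_asph n x) (fun A B => @flag_sub s.1 x A B) (@sc x)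
  (@sS x) #|` fset_set V|.
have cardV A : flag s.1 x A -> (#|` A| <= #|` fset_set V|)%N.
  by move=> /flagV/fsubset_leq_card.
(* Conditional on [A] being a flag, so that [Q] may intersect over all subsets of the finite vertex
   set. *)
pose O A := [set z | flag s.1 x A -> h @` cube A `<=` phi_ #|` A| z].
have oO A : nbhs x (O A).
  have [fA|nfA] := pselect (flag s.1 x A); last by apply: filterE => z /nfA.
  have : open_nbhs x [set z | h @` cube A `<=` phi_ #|` A| z].
    split; first by apply/phi_llc/continuous_compact;
      [apply: hc => //; exact: cardV|exact: compact_cube].
    by move=> _ [t At <-]; apply: hS => //; exact: cardV.
  by move=> /open_nbhs_nbhs Oz; apply: filterS Oz => z Oz _.
pose Q := (N `&` \bigcap_(A in [set` fpowerset (fset_set V)]) O A)°.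
have QN z : Q z -> N z by move=> /interior_subset[].
exists (h, Q); split => /=.
- split; first exact: open_interior.
  apply: (@filterI _ (nbhs x)); first by apply: open_nbhs_nbhs; split.
  by apply: filter_bigI => A _.
- by move=> A t fA; exact: hg.
- by move=> A fA; apply: hc => //; exact: cardV.
- move=> z Qz A [AW Ainj]; split => // a /AW[Wa az]; split => //.
  by apply: cN => //; exists z; split => //; exact: QN.
- move=> z A t /interior_subset[_ QO] fA At.
  apply: (QO A _ fA); last by exists t.
  by rewrite /= fpowersetE flagV.
Qed.

(** A new vertex [(n, G)] acts as apex of the cone built at the centre [c G]: forgetting its
    coordinate sends a simplex to the cube on its other vertices, and the vertex itself to 0. Flags
    involve closures, so closures of the new members must lie in the sets [Q x]. *)
Lemma stage_step (x0 : X) n s : stage n s -> exists s' : set I * (T -> Y),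
  [/\ stage n.+1 s', s.1 `<=` s'.1, open_cover [set G | s'.1 (n, G)] &
      forall t : T, (forall a, (n <= a.1)%N -> t a = 0) -> s'.2 t = s.2 t].
Proof.
move=> st; have [lev lf sc sS] := st.
have /choice[hQ hQP] := fun x => stage_cone x st.
pose h x := (hQ x).1; pose Q x := (hQ x).2.
have Qcov : open_cover (range Q).
  split=> [_ [x _ <-]|]; first by have [[]] := hQP x.
  by apply/seteqP; split => // x _; exists (Q x) => //; have [[]] := hQP x.
have [VG [[oG cG] lG rG]] := paracompact_closure_refine X_hausdorff X_paracompact Qcov.
have /choice[c cP] : forall G, exists x, VG G -> closure G `<=` Q x.
  move=> G; have [/rG[_ [x _ <-] GQ]|nG] := pselect (VG G); first by exists x.
  by exists x0.
pose restr (t : T) : T := fun a => if (a.1 < n)%N then t a else 0.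
have crestr : continuous restr.
  move=> t; apply: (@cvg_ptws _ _ _ (nbhs t) restr) => a; rewrite /restr.
  case: ifP => _; last exact: cvg_cst.
  exact: (@continuous_ptws_proj I R a).
pose W := s.1 `|` [set a | a.1 = n /\ VG a.2].
(* The choice of [G] is harmless: on the simplex of a flag at most one coordinate of level [n] is
   nonzero. *)
pose g' (t : T) := if pselect (exists G, VG G /\ t (n, G) != 0) is left e
  then h (c (projT1 (cid e))) (restr t) else s.2 t.
have sn G : ~ s.1 (n, G) by move=> /lev; rewrite ltnn.
have WVG G : W (n, G) -> VG G by move=> [/sn//|[]].
have flag_old z A : flag W z A -> (forall G, (n, G) \notin A) -> flag s.1 z A.
  move=> [AW Ainj] nA; split => // -[m G] aA; have [[//|[/= mn GG]] cl] := AW _ aA.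
  by move: aA (nA G); rewrite mn => ->.
have g'_old t : (forall G, t (n, G) = 0) -> g' t = s.2 t.
  move=> t0; rewrite /g'; case: pselect => // e; exfalso; case: e => G [_].
  by rewrite t0 eqxx.
have flag_new z A G : flag W z A -> (n, G) \in A ->
    [/\ VG G, flag s.1 z (A `\ (n, G))%fset, Q (c G) z & #|` A|.-1 = #|` (A `\ (n, G))%fset|].
  move=> fA GA; have [AW Ainj] := fA; have [/WVG GG clG] := AW _ GA.
  split => //; last by have := cardfsD1 (n, G) A; rewrite GA => ->.
    apply: flag_old; first exact: flag_sub fA (fsubD1set _ _).
    move=> G'; rewrite in_fsetD1 negb_and negbK -implyNb; apply/implyP => G'G.
    by apply: contra G'G => G'A; apply/eqP; exact: Ainj.
  exact: cP.
have restr_cube A G t : {in A &, injective fst} -> (n, G) \in A -> cube A t ->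
    cube (A `\ (n, G))%fset (restr t).
  move=> Ainj GA At; apply: cubeP => a; rewrite /restr.
    by case: ifP => _; [exact: cube01 At|rewrite lexx ler01].
  rewrite in_fsetD1 negb_and negbK => /orP[/eqP ->/=|aA]; first by rewrite ltnn.
  by case: ifP => // _; exact: cube_out At aA.
have g'_new z A G t : flag W z A -> (n, G) \in A -> simplex A t ->
    g' t = h (c G) (restr t).
  move=> fA GA [At [b tb]]; have [GG fA0 Qz cA] := flag_new _ _ _ fA GA.
  have [AW Ainj] := fA.
  have inA a : t a != 0 -> a \in A by apply: contraR => /(cube_out At) ->.
  rewrite /g'; case: pselect => [e|ne].
    case: (cid e) => G' /= [G'G /inA G'A].
    by have [] := Ainj (n, G') (n, G) G'A GA erefl => ->.
  (* On the face opposite the new vertex both formulas agree: the old vertices form a flag at [c G]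
     too, where the cone map extends [s.2]. *)
  have tG : t (n, G) = 0.
    by apply: contrapT => /eqP tG; apply: ne; exists G.
  have At0 : cube (A `\ (n, G))%fset t by exact: cube_fsetD1.
  have -> : restr t = t.
    apply/funext => a; rewrite /restr; case: ifPn => // an.
    rewrite (cube_out At0)//; apply: contra an => aA0.
    by have [/(_ _ aA0)[/lev]] := fA0.
  have [_ hg _ Qflag _] := hQP (c G).
  rewrite -(hg (A `\ (n, G))%fset)//; first by apply: Qflag fA0.
  by split => //; exists b.
exists (W, g'); split => /=.
- split => /=.
  + by move=> a [/lev/ltnW//|[-> _]].
  + apply: locally_finite_familyU lf _ => x; have [N Nx fN] := lG x.
    exists N => //; apply: sub_finite_set (finite_image (fun G => (n, G)) fN).
    by move=> [_ G] [[/= -> GG] GN]; exists G.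
  + move=> z A fA; have [[G GA]|nG] := pselect (exists G, (n, G) \in A).
      have [GG fA0 Qz cA] := flag_new _ _ _ fA GA.
      have [_ _ hc Qflag _] := hQP (c G).
      apply: (@within_continuous_eq _ _ _ (fun t => h (c G) (restr t))).
        by move=> t At; rewrite (g'_new _ _ _ _ fA GA At).
      apply: (@within_continuous_compW _ _ _ _ (cube (A `\ (n, G))%fset)).
      * exact: continuous_subspaceT.
      * by move=> t [At _]; apply: restr_cube => //; case: fA.
      * by apply: hc; exact: Qflag Qz _ fA0.
    have nA G : (n, G) \notin A by apply/negP => GA; apply: nG; exists G.
    apply: within_continuous_eq (sc z A (flag_old _ _ fA nA)) => t [At _].
    by rewrite g'_old// => G; exact: cube_out At (nA G).
  + move=> z A t fA At; have [[G GA]|nG] := pselect (exists G, (n, G) \in A).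
      have [GG fA0 Qz cA] := flag_new _ _ _ fA GA.
      have [_ _ _ Qflag hS] := hQP (c G).
      (* A simplex of dimension k has k vertices besides the new one, so the cone lands in exactly
         the required [phi_ k]. *)
      rewrite (g'_new _ _ _ _ fA GA At) cA; apply: hS => //; first exact: Qflag fA0.
      by apply: restr_cube; [case: fA|exact: GA|case: At].
    have nA G : (n, G) \notin A by apply/negP => GA; apply: nG; exists G.
    rewrite g'_old; first by apply: sS At; exact: flag_old.
    by move=> G; case: At => At _; exact: cube_out At (nA G).
- by move=> a sa; left.
- have -> : [set G | W (n, G)] = VG.
    by apply/seteqP; split=> G; [exact: WVG|right].
  by split.
- by move=> t t0; apply: g'_old => G; exact: t0.
Qed.

Lemma C_space_selection : C_space X ->
  exists f : X -> Y, continuous f /\ selection (union_map phi_) f.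
Proof.
move=> X_C.
(* Empty [X] is treated apart: the defaults [x0] and [y0] come from a point of [X]. *)
have [[x0 _]|nX] := pselect (exists x : X, True); last first.
  have X0 (x : X) : False by apply: nX; exists x.
  by exists (fun x => False_rect Y (X0 x)); split => x; case: (X0 x).
have [y0 _] := phi0 0 x0.
have /choice[F FP] : forall ns : nat * (set I * (T -> Y)),
    exists s' : set I * (T -> Y), stage ns.1 ns.2 ->
    [/\ stage ns.1.+1 s', ns.2.1 `<=` s'.1, open_cover [set G | s'.1 (ns.1, G)] &
      forall t : T, (forall a, (ns.1 <= a.1)%N -> t a = 0) -> s'.2 t = ns.2.2 t].
  move=> [n s]; have [/(stage_step x0)[s' s'P]|ns] := pselect (stage n s).
    by exists s'.
  by exists s.
(* Without vertices every simplex of a flag is empty, so a constant map is a valid stage 0. *)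
pose st := nat_rect (fun=> (set I * (T -> Y))%type) (set0, cst y0)
  (fun n s => F (n, s)).
have stS n : stage n (st n).
  elim: n => [|n IHn]; last by have [] := FP (n, st n) IHn.
  split => //=.
  - by move=> x; exists setT; [exact: filterT|apply: sub_finite_set (finite_set0 _) => a []].
  - by move=> x A _; apply: continuous_subspaceT; exact: cst_continuous.
  - by move=> x A t [A0 _] /simplexP[a /A0[]].
have st_next n := FP (n, st n) (stS n).
have st_mono m n : (m <= n)%N -> (st m).1 `<=` (st n).1.
  elim: n => [|n IHn]; first by rewrite leqn0 => /eqP ->.
  rewrite leq_eqVlt => /orP[/eqP -> //|/IHn mn a /mn].
  by have [_ + _ _] := st_next n; exact.
(* Stabilization: from stage [m] on, the map no longer changes at points supported on levels below
   [m]. *)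
have st_ext m n (t : T) : (m <= n)%N -> (forall a, (m <= a.1)%N -> t a = 0) ->
    (st n).2 t = (st m).2 t.
  move=> + t0; elim: n => [|n IHn]; first by rewrite leqn0 => /eqP ->.
  rewrite leq_eqVlt => /orP[/eqP -> //|]; rewrite ltnS => mn.
  rewrite -(IHn mn); have [_ _ _] := st_next n; apply => a na.
  by apply: t0; exact: leq_trans mn na.
(* Vertices of level [n] are added in passing from stage [n] to stage [n.+1]. *)
pose U_ n := [set G | (st n.+1).1 (n, G)].
have [V_ [oV trV refV covV]] : exists V_ : nat -> set (set X),
    [/\ forall n, open_family (V_ n), forall n, trivIset (V_ n) id,
        forall n, refines (V_ n) (U_ n) & covers_space (\bigcup_n V_ n)].
  by apply: X_C => n; have [] := st_next n.
pose O_ n := \bigcup_(B in V_ n) B.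
have oO n : open (O_ n) by apply: bigcup_open => B; exact: oV.
have cO : \bigcup_n O_ n = setT.
  apply/seteqP; split => // x _; have : [set: X] x by [].
  by rewrite -covV => -[B [n _ VB] Bx]; exists n => //; exists B.
have [p [cp p01 pO p1 plf]] :=
  paracompact_max_partition X_hausdorff X_paracompact R oO cO.
have /choice[M MP] := plf.
have /choice[r rP] : forall nB : nat * set X, exists G, V_ nB.1 nB.2 ->
    U_ nB.1 G /\ nB.2 `<=` G.
  move=> [n B]; have [/refV[G UG BG]|nV] := pselect (V_ n B); first by exists G.
  by exists B.
have /choice[v vP] : forall nx : nat * X, exists B, O_ nx.1 nx.2 ->
    V_ nx.1 B /\ B nx.2.
  move=> [n x]; have [[B VB Bx]|nO] := pselect (O_ n x); first by exists B.
  by exists set0.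
(* The level [n] vertex at [x]: a member of [U_ n] around the member of [V_ n] containing [x]. It is
   meaningful only on [O_ n]. *)
pose w n x := r (n, v (n, x)).
have wU n x : O_ n x -> (st n.+1).1 (n, w n x) /\ w n x x.
  by move=> /(vP (n, x))[VB Bx]; have [UG] := rP (n, v (n, x)) VB; split => //; exact: b.
(* Disjointness of [V_ n] enters here: points of one member determine that same member. *)
have w_loc n x : O_ n x -> \forall y \near x, w n y = w n x.
  move=> Ox; have [/= VB Bx] := vP (n, x) Ox.
  have : nbhs x (v (n, x)) by apply: open_nbhs_nbhs; split => //; exact: oV VB.
  apply: filterS => y By; rewrite /w.
  have Oy : O_ n y by exists (v (n, x)).
  have [/= VB' B'y] := vP (n, y) Oy.
  by rewrite (trV n _ _ VB' VB)//; exists y.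
pose tau x : T := fun a => if a.2 == w a.1 x then p a.1 x else 0.
have p_out n x : ~ O_ n x -> p n x = 0.
  by move=> nO; apply/eqP; apply: contraPT (@pO n x) => pn; apply/not_implyP.
have tau01 x a : 0 <= tau x a <= 1.
  by rewrite /tau; case: ifP => _ //; rewrite lexx ler01.
have ctau : continuous tau.
  move=> x; apply: (@cvg_ptws _ _ _ (nbhs x) tau) => -[n G]; rewrite /tau /=.
  have [Ox|nOx] := pselect (O_ n x).
    have [->|Gw] := eqVneq G (w n x).
      apply: cvg_trans (cp n x); apply: near_eq_cvg.
      by apply: filterS (w_loc n x Ox) => y ->; rewrite eqxx.
    apply: cvg_near_cst.
    by apply: filterS (w_loc n x Ox) => y ->; rewrite (negbTE Gw).
  (* Off [O_ n] the vertex may jump, but its coordinate lies between 0 and [p n], which tends to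
     0. *)
  rewrite p_out// if_same.
  apply: (@squeeze_cvgr _ _ _ _ (cst 0) (p n)).
  - by apply: nearW => y; have /andP[p0 _] := p01 n y; case: ifP => _; rewrite ?lexx ?p0.
  - exact: cvg_cst.
  - by have := cp n x; rewrite /continuous_at p_out.
pose bound m x := forall n, (m <= n)%N -> p n x = 0.
have tau_bound m x : bound m x -> forall a, (m <= a.1)%N -> tau x a = 0.
  by move=> mx a /mx pa; rewrite /tau pa if_same.
have MxP x : bound (M x) x by have /nbhs_singleton := MP x.
have tau_flag m x : bound m x -> exists A : {fset I},
    [/\ flag (st m).1 x A, simplex A (tau x) &
      forall a, a \in A -> (st m).1 a /\ a.2 x].
  move=> mx; pose V := [set a | tau x a != 0].
  have VE a : V a -> [/\ a.2 = w a.1 x, (st m).1 a & a.2 x].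
    move=> Va; have aw : a.2 = w a.1 x.
      by move: Va; rewrite /V /= /tau; case: (a.2 =P w a.1 x) => //; rewrite eqxx.
    have pa : p a.1 x != 0 by move: Va; rewrite /V /= /tau aw eqxx.
    have [sw wx] := wU _ _ (pO _ _ pa); split => //; last by rewrite aw.
    have am : (a.1 < m)%N by rewrite ltnNge; apply: contra pa => /mx ->.
    apply: (st_mono a.1.+1 m am).
    by move: sw; rewrite -aw; case: (a).
  have finV : finite_set V.
    apply: sub_finite_set (finite_image (fun n => (n, w n x)) (finite_II m)).
    move=> a Va; exists a.1; last by have [<- _ _] := VE a Va; case: (a).
    by rewrite /= ltnNge; apply: contra Va => /(tau_bound m x mx) ->.
  have inV a : (a \in fset_set V) = (tau x a != 0).
    by rewrite in_fset_set//; apply/idP/idP; rewrite inE.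
  exists (fset_set V); split.
  - split=> [a|a b]; rewrite !inV; first by move=> /VE[_ ? ?]; split => //; exact: subset_closure.
    move=> /VE[aw _ _] /VE[bw _ _] ab.
    by apply/eqP; rewrite -pair_eqE /pair_eq /= ab eqxx aw bw ab /=.
  - split; last by have [n pn] := p1 x; exists (n, w n x); rewrite /tau /= eqxx.
    by apply: cubeP => // a; rewrite inV negbK => /eqP.
  - by move=> a; rewrite inV => /VE[].
pose f x := (st (M x)).2 (tau x).
(* Any stage past a bound computes [f], so a single stage serves a whole neighbourhood. *)
have fE m x : bound m x -> f x = (st m).2 (tau x).
  move=> mx; rewrite /f; have [Mm|mM] := leqP (M x) m.
    by rewrite [RHS](st_ext (M x))//; exact: tau_bound.
  by apply: st_ext; [exact: ltnW|exact: tau_bound].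
exists f; split; last first.
  move=> x; have [A [fA At _]] := tau_flag _ _ (MxP x).
  by exists #|` A|.-1 => //; have [_ _ _ sS] := stS (M x); exact: sS.
move=> x; pose m := M x.
have [lev lf sc _] := stS m.
have [N Nx finN] := lf x.
pose D := fpowerset (fset_set [set a | (st m).1 a /\ a.2 `&` N !=set0]).
(* The flag condition does not involve [y], so [C A] is empty or the preimage of a closed cube. By
   local finiteness the sets [C A], [A] in [D], cover a neighbourhood of [x], and continuity is
   pasted from them. *)
pose C A := [set y | (exists z, flag (st m).1 z A) /\ cube A (tau y)].
have clC A : closed (C A).
  have [Az|nA] := pselect (exists z, flag (st m).1 z A); last first.
    rewrite (_ : C A = set0); first exact: closed0.
    by apply/seteqP; split => y // [/nA].
  rewrite (_ : C A = tau @^-1` cube A); last by apply/seteqP; split => y // [].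
  by have /continuous_closedP := ctau; apply; exact: closed_cube.
have cF : (fun y => (st m).2 (tau y)) @ within (\bigcup_(A in [set` D]) C A) (nbhs x)
    --> (st m).2 (tau x).
  apply: (@cvg_within_closed_cover _ _ (fun y => (st m).2 (tau y)) _ D C x) => // A _ Cx.
  have [[z fA] _] := Cx.
  apply: within_continuous_cvg (@subset_refl _ (C A)) Cx.
  apply: within_continuous_compW (sc z A fA); first exact: continuous_subspaceT.
  move=> y [_ At]; split => //; have [n pn] := p1 y.
  by exists (n, w n y); rewrite /tau /= eqxx.
move=> W; rewrite (fE m x (MxP x)) => /cF FW.
have {}FW : nbhs x [set y | (\bigcup_(A in [set` D]) C A) y -> W ((st m).2 (tau y))] := FW.
have : nbhs x [set y | W (f y)]; last by [].
near=> y => /=.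
have my : bound m y by near: y; exact: MP.
rewrite (fE m y my).
have [A [fA At Asub]] := tau_flag m y my.
have Ny : N y by near: y.
have : (\bigcup_(A in [set` D]) C A) y.
  exists A; last by split; [exists y|case: At].
  rewrite /= fpowersetE; apply/fsubsetP => a /Asub[sa ay].
  by rewrite in_fset_set// inE; split => //; exists y.
by near: y.
Unshelve. all: by end_near. Qed.

End Stages.

(** * The C-property from selections *)

Section Sphere.
Context {R : realType} {n : nat}.
Implicit Types y : 'rV[R]_n.+1.

Lemma unit_sphereE y : unit_sphere R n y <-> norm2 y = 1.
Proof.
rewrite /unit_sphere/= -norm2_sqr; split=> [/eqP|->]; last by rewrite expr1n.
by rewrite sqrf_eq1 => /orP[/eqP //|/eqP y1]; have := sqrtr_ge0 (\sum_i y 0 i ^+ 2);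
  rewrite -/(norm2 y) y1; lra.
Qed.

Lemma unit_ballE y : unit_ball R n.+1 y -> 0 <= norm2 y <= 1.
Proof.
rewrite /unit_ball/= -norm2_sqr => y1; have y0 : 0 <= norm2 y by exact: sqrtr_ge0.
by rewrite y0/=; nra.
Qed.

Lemma unit_sphere_normalize y : y != 0 -> unit_sphere R n ((norm2 y)^-1 *: y).
Proof.
move=> y0; have n0 : norm2 y != 0 by apply: contra_neq y0; exact: norm2_eq0.
apply/unit_sphereE; rewrite norm2Z ?invr_ge0 ?sqrtr_ge0//.
by rewrite mulVf.
Qed.

End Sphere.

Section Join.
Context {R : realType} {X : topologicalType}.
Variable W : nat -> set (set X).
Hypothesis W_cover : forall n, open_cover (W n).
Hypothesis W_lf : forall n, locally_finite (W n).

Local Notation I := (nat * set X)%type.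
Local Notation T := {ptws I -> R}.

(* Cones over the joins of the discrete spaces [{G | W i G /\ G x}], [i <= n],
   with the apex removed: dropping the normalization of barycentric coordinates
   does not change the homotopy type. *)
Definition join_map (n : nat) (x : X) : set T :=
  [set t | [/\ forall a, 0 <= t a <= 1, exists a, t a != 0,
    forall a, t a != 0 -> [/\ (a.1 <= n)%N, W a.1 a.2 & a.2 x] &
    forall a b, t a != 0 -> t b != 0 -> a.1 = b.1 -> a = b]].

Definition vertex (a : I) : T := fun b => (b == a)%:R.

Lemma join_map_vertex n x a : (a.1 <= n)%N -> W a.1 a.2 -> a.2 x ->
  join_map n x (vertex a).
Proof.
move=> an Wa ax; have v0 b : vertex a b != 0 -> b = a.
  by rewrite /vertex pnatr_eq0 eqb0 negbK => /eqP.
split=> [b||b /v0 -> //|b c /v0 -> /v0 -> //].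
  by rewrite /vertex ler0n lern1; case: (_ == _).
by exists a; rewrite /vertex eqxx oner_neq0.
Qed.

Lemma cover_mem n (x : X) : exists2 G, W n G & G x.
Proof.
have [_ cW] := W_cover n; have : [set: X] x by [].
by rewrite -cW => -[G WG Gx]; exists G.
Qed.

Lemma join_map_nonempty n : nonempty_valued (join_map n).
Proof.
move=> x; have [G WG Gx] := cover_mem 0%N x.
by exists (vertex (0%N, G)); exact: join_map_vertex.
Qed.

(* By local finiteness only finitely many vertices occur in [join_map n x]. *)
Lemma join_map_llc n : lower_locally_constant (join_map n).
Proof.
move=> K _; rewrite openE => x Kx.
pose V := [set a : I | [/\ (a.1 <= n)%N, W a.1 a.2 & a.2 x]].
have finV : finite_set V.
  pose Vi i := (fun G => (i, G)) @` [set G | W i G /\ G x].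
  apply: (@sub_finite_set _ _ (\bigcup_(i in `I_n.+1) Vi i)).
    by move=> [i G] [/= ni WG Gx]; exists i => //; exists G.
  apply: bigcup_finite; first exact: finite_II.
  move=> i _; apply: finite_image; have [N Nx finN] := W_lf i x.
  apply: sub_finite_set finN => G [WG Gx]; split => //; exists x; split => //.
  exact: nbhs_singleton.
have : nbhs x (\bigcap_(a in [set` fset_set V]) a.2).
  apply: filter_bigI => a; rewrite in_fset_set// inE => -[_ Wa ax].
  by apply: open_nbhs_nbhs; split => //; have [oW _] := W_cover a.1; exact: oW.
apply: filterS => z Vz t /Kx [t01 tn0 tV tinj]; split => // a ta.
have [an Wa ax] := tV _ ta; split => //.
by apply: Vz; rewrite /= in_fset_set// inE.
Qed.

(** The ball is filled radially from [e] at the centre to [f] on the sphere. Values of [f] use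
    levels up to [n] only, so adding [e] keeps one vertex per level. *)
Lemma join_map_aspherical : aspherical R join_map.
Proof.
move=> n x f cf fS.
have [G WG Gx] := cover_mem n.+1 x; pose e : I := (n.+1, G).
have {}fS y : unit_sphere R n y -> join_map n x (f y) by move=> yS; apply: fS; exists y.
pose rho (y : 'rV[R]_n.+1) := (norm2 y)^-1 *: y.
pose g y : T := fun a => norm2 y * f (rho y) a + (1 - norm2 y) * vertex e a.
have frho y a : y != 0 -> 0 <= f (rho y) a <= 1.
  by move=> y0; have [+ _ _ _] := fS _ (unit_sphere_normalize y0); exact.
have n20 : norm2 (0 : 'rV[R]_n.+1) = 0.
  by rewrite -[X in norm2 X](scale0r 0) norm2Z// mul0r.
have cg : continuous g.
  move=> y; apply: (@cvg_ptws _ _ _ (nbhs y) g) => a.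
  have c2 := @norm2_continuous R n.+1 y.
  suff cfr : (fun z => norm2 z * f (rho z) a) @ nbhs y --> norm2 y * f (rho y) a.
    apply: (cvgD cfr); apply: (cvgM (cvgB (cvg_cst _) c2)).
    exact: cvg_cst.
  (* At the origin [rho] has no limit, but the coordinates of [f] on the sphere lie in [0, 1] and
     the factor [norm2] tends to 0. *)
  have [->|y0] := eqVneq y 0.
    rewrite n20 mul0r; apply: (@squeeze_cvgr _ _ _ _ (cst 0) norm2).
    - apply: nearW => z; have z2 : 0 <= norm2 z by exact: sqrtr_ge0.
      have [->|/(frho z a)/andP[? ?]] := eqVneq z 0; first by rewrite n20 mul0r lexx.
      by rewrite mulr_ge0//= ler_piMr.
    - exact: cvg_cst.
    - by have := @norm2_continuous R n.+1 0; rewrite /continuous_at n20.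
  apply: (cvgM c2) => U Ufy.
  have n0 : norm2 y != 0 by apply: contra_neq y0; exact: norm2_eq0.
  have crho : {for y, continuous rho} := continuous_rescale n0 c2.
  have ca : nbhs (f (rho y)) [set t : T | U (t a)].
    exact: (@continuous_ptws_proj I R a _ _ Ufy).
  move/subspace_continuousP : cf => /(_ _ (unit_sphere_normalize y0) _ ca) cfa.
  have {}cfa : nbhs (rho y) [set z | unit_sphere R n z -> U (f z a)] := cfa.
  have : nbhs y [set z | U (f (rho z) a)]; last by [].
  have nz : nbhs y [set z | norm2 z != 0].
    have nr : nbhs (norm2 y) [set r : R | r != 0].
      by apply: open_nbhs_nbhs; split => //; exact: open_neq.
    exact: (c2 _ nr).
  near=> z => /=.
  have z0 : z != 0.
    have : norm2 z != 0 by near: z.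
    by apply: contra_neq => ->.
  have := unit_sphere_normalize z0; near: z.
  exact: (crho _ cfa).
exists g; split; first exact: continuous_subspaceT.
- move=> _ [y yB <-]; have /andP[s0 s1] := unit_ballE yB.
  have jv : join_map n.+1 x (vertex e) by exact: join_map_vertex.
  have [y0|y0] := eqVneq y 0.
    suff -> : g y = vertex e by [].
    by apply/funext => a; rewrite /g y0 n20 mul0r add0r subr0 mul1r.
  have [c01 [a0 ca0] cV cinj] := fS _ (unit_sphere_normalize y0).
  have ve a : vertex e a = (a == e)%:R by [].
  have supp a : g y a != 0 -> f (rho y) a != 0 \/ a = e.
    rewrite /g ve; have [->|ae] := eqVneq a e; first by right.
    by rewrite mulr0 addr0 mulf_eq0 negb_or => /andP[_ ?]; left.
  have [v01 _ _ _] := jv.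
  split.
  + move=> a; have /andP[? ?] := c01 a; have /andP[? ?] := v01 a.
    rewrite -/(rho y) in c01 *; rewrite /g; apply/andP; split; first by
      rewrite addr_ge0// mulr_ge0// subr_ge0.
    rewrite -[leRHS](subrK (norm2 y)) [leRHS]addrC lerD//; first exact: ler_piMr.
    by rewrite ler_piMr// subr_ge0.
  (* The excluded apex 0 is avoided: on the sphere by [f], inside it by the positive coordinate at
     [e]. *)
  + have [s1'|s1'] := eqVneq (norm2 y) 1.
      by exists a0; rewrite /g s1' mul1r subrr mul0r addr0.
    exists e; rewrite /g ve eqxx mulr1 gt_eqF// ltr_wpDl//.
      by have /andP[? _] := c01 e; rewrite mulr_ge0.
    by rewrite subr_gt0 lt_neqAle s1'.
  + move=> a /supp[/cV[an Wa ax]|->]; split => //; exact: leqW.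
  + have ne a : f (rho y) a != 0 -> a.1 <> n.+1.
      by move=> /cV[an _ _] aE; move: an; rewrite aE ltnn.
    move=> a b /supp[ca|->] /supp[cb|->] //=; first exact: cinj.
      by move=> /(ne a).
    by move/esym/(ne b).
- move=> y /unit_sphereE y1; apply/funext => a.
  by rewrite /g /rho y1 invr1 scale1r mul1r subrr mul0r addr0.
Unshelve. all: by end_near. Qed.

End Join.

(** A point of the join at [x] uses only sets containing [x], which gives refinement, and has a
    nonzero coordinate, which gives covering; one vertex per level gives disjointness. *)
Lemma selections_C_space (R : realType) (X : topologicalType) :
  paracompact X ->
  (forall Y : topologicalType, hausdorff_space Y ->
   forall phi_ : nat -> X -> set Y,
     (forall n, nonempty_valued (phi_ n)) ->
     (forall n, lower_locally_constant (phi_ n)) ->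
     aspherical R phi_ ->
     exists f : X -> Y, continuous f /\ selection (union_map phi_) f) ->
  C_space X.
Proof.
move=> X_paracompact sel U_ oU.
have /choice[W WP] := fun n => X_paracompact _ (oU n).
have W_cover n : open_cover (W n) by have [] := WP n.
have W_lf n : locally_finite (W n) by have [] := WP n.
have T2 : hausdorff_space {ptws nat * set X -> R}.
  by apply: (@hausdorff_product _ (fun=> R)) => _; exact: Rhausdorff.
have [f [cf fS]] := sel _ T2 _ (@join_map_nonempty R X W W_cover)
  (@join_map_llc R X W W_cover W_lf) (@join_map_aspherical R X W W_cover).
pose B n G := [set x | f x (n, G) != 0].
exists (fun n => [set B n G | G in W n]); split.
- move=> n _ [G WG <-]; apply: (@open_comp _ _ (fun x => f x (n, G)) [set r | r != 0]).
    move=> x _.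
    have cp := @continuous_ptws_proj (nat * set X)%type R (n, G).
    exact: (@continuous_comp _ _ _ f
      (fun t : {ptws nat * set X -> R} => t (n, G)) x (cf x) (cp (f x))).
  exact: open_neq.
- move=> n _ _ [G WG <-] [G' WG' <-] [x [Bx B'x]].
  have [k _ [_ _ _ inj]] := fS x.
  by have [->] := inj _ _ Bx B'x erefl.
- move=> n _ [G WG <-]; have [_ + _] := WP n => /(_ G WG)[H UH GH].
  exists H => // x Bx; apply: GH; have [k _ [_ _ fV _]] := fS x.
  by have [] := fV _ Bx.
- apply/seteqP; split => // x _; have [k _ [_ [[n G] fa] fV _]] := fS x.
  have [_ WG _] := fV _ fa.
  by exists (B n G) => //; exists n => //; exists G.
Qed.

Theorem theorem1p2 (R : realType) (X : topologicalType)
    (X_hausdorff : hausdorff_space X) (X_paracompact : paracompact X) :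
  C_space X <->
  (forall Y : topologicalType, hausdorff_space Y ->
   forall phi_ : nat -> X -> set Y,
     (forall n, nonempty_valued (phi_ n)) ->
     (forall n, lower_locally_constant (phi_ n)) ->
     aspherical R phi_ ->
     exists f : X -> Y, continuous f /\ selection (union_map phi_) f).
Proof.
split=> [X_C Y _ phi_ phi0 phi_llc phi_asph|].
  exact: C_space_selection phi_asph X_C.
exact: selections_C_space.
Qed.
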